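(* The Daugavet property is inherited by $M$-ideals: if $X$ is a real Banach space with the Daugavet property and $J\subset X$ is an $M$-ideal in $X$, then $J$ has the Daugavet property.
   Context: A Banach space $X$ has the Daugavet property if $\|\mathrm{Id}+T\|=1+\|T\|$ for every bounded linear operator $T\colon X\to X$ of rank $1$. An $M$-ideal in a Banach space $X$ is a closed subspace $J$ such that $X^*=V\oplus_1 J^\perp$ for some closed subspace $V$ of $X^*$, where $J^\perp=\{x^*\in X^*: x^*|_J=0\}$ and $\oplus_1$ means that $\|v+w\|=\|v\|+\|w\|$ for all $v\in V$, $w\in J^\perp$. *)

(* Defs.v *)
From HB Require Import structures.
From mathcomp Require Import all_boot all_order all_algebra.
From mathcomp Require Import all_classical all_reals.
From mathcomp Require Import topology normedtype sequences.

Set Implicit Arguments.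
Unset Strict Implicit.
Unset Printing Implicit Defensive.

Import Order.TTheory GRing.Theory Num.Theory.
Import numFieldNormedType.Exports.

Local Open Scope classical_set_scope.
Local Open Scope ring_scope.

Section bounded_operators.
Context {R : realType} (X Y : normedModType R).

Definition bounded_op : set (X -> Y) :=
  [set f | linear f /\ exists M : R, forall x, `|f x| <= M * `|x|].

Lemma bounded_op_submod_closed : submod_closed (mem bounded_op).
Proof.
split.
  apply/mem_set; split.
    by move=> a u v; rewrite /= scaler0 addr0.
  by exists 0 => x; rewrite normr0 mul0r.
move=> a f g /set_mem[lf [M fM]] /set_mem[lg [N gN]]; apply/mem_set; split.
  move=> b u v; rewrite !fctE lf lg !scalerDr !scalerA mulrC.
  by rewrite -!addrA; congr +%R; rewrite addrCA.
exists (`|a| * M + N) => x; rewrite !fctE.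
rewrite (le_trans (ler_normD _ _))// mulrDl lerD//.
by rewrite normrZ -mulrA ler_wpM2l.
Qed.

Definition bounded_op_pred : {pred X -> Y} := mem bounded_op.

HB.instance Definition _ := GRing.isSubmodClosed.Build R (X -> Y : lmodType R)
  bounded_op_pred bounded_op_submod_closed.

Record boundedOp := BoundedOp {
  bop_fun :> X -> Y;
  _ : bop_fun \in bounded_op_pred }.

HB.instance Definition _ := [isSub for bop_fun].
HB.instance Definition _ := [Choice of boundedOp by <:].
HB.instance Definition _ := [SubChoice_isSubLmodule of boundedOp by <:].

Lemma bopP (T : boundedOp) :
  linear T /\ exists M : R, forall x, `|T x| <= M * `|x|.
Proof. by have /set_mem := valP T. Qed.

Lemma bop0 (T : boundedOp) : T 0 = 0.
Proof.
have [lT _] := bopP T.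
by have := lT (-1) 0 0; rewrite scaler0 addr0 scaleN1r addNr.
Qed.

Lemma bopZ (T : boundedOp) a x : T (a *: x) = a *: T x.
Proof.
by have [lT _] := bopP T; have := lT a x 0; rewrite !addr0 bop0 addr0.
Qed.

Definition opnorm (T : boundedOp) : R :=
  sup [set `|T x| | x in [set x | `|x| <= 1]].

Lemma opnorm_has_sup (T : boundedOp) :
  has_sup [set `|T x| | x in [set x : X | `|x| <= 1]].
Proof.
split; first by exists `|T 0|, 0 => //=; rewrite normr0.
have [_ [M TM]] := bopP T.
exists `|M| => _ [x /= x1 <-]; apply: (le_trans (TM x)).
rewrite (le_trans (ler_norm _))// normrM normr_id.
by rewrite ler_piMr.
Qed.

Lemma opnorm_ub (T : boundedOp) x : `|x| <= 1 -> `|T x| <= opnorm T.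
Proof. by move=> x1; apply: sup_upper_bound; [exact: opnorm_has_sup|exists x]. Qed.

Lemma opnorm_le (T : boundedOp) (c : R) :
  (forall x, `|x| <= 1 -> `|T x| <= c) -> opnorm T <= c.
Proof.
move=> h; apply: ge_sup; first by case: (opnorm_has_sup T).
by move=> _ [x x1 <-]; exact: h.
Qed.

Lemma opnorm_ge0 (T : boundedOp) : 0 <= opnorm T.
Proof. by rewrite (le_trans (normr_ge0 (T 0)))// opnorm_ub// normr0. Qed.

Lemma opnormP (T : boundedOp) x : `|T x| <= opnorm T * `|x|.
Proof.
have [->|x0] := eqVneq x 0; first by rewrite bop0 !normr0 mulr0.
have nx0 : 0 < `|x| by rewrite normr_gt0.
have := @opnorm_ub T (`|x|^-1 *: x).
rewrite bopZ !normrZ normfV normr_id mulVf ?gt_eqF// => /(_ (lexx _)).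
by rewrite mulrC ler_pdivrMr.
Qed.

Lemma opnormD (S T : boundedOp) : opnorm (S + T) <= opnorm S + opnorm T.
Proof.
apply: opnorm_le => x x1; rewrite (le_trans (ler_normD _ _))//.
by rewrite lerD// opnorm_ub.
Qed.

Lemma opnormZ (a : R) (T : boundedOp) : opnorm (a *: T) = `|a| * opnorm T.
Proof.
have aT b (S : boundedOp) : opnorm (b *: S) <= `|b| * opnorm S.
  by apply: opnorm_le => x x1; rewrite normrZ ler_wpM2l// opnorm_ub.
have [->|a0] := eqVneq a 0.
  apply/eqP; rewrite eq_le aT/= normr0 mul0r; exact: opnorm_ge0.
apply/eqP; rewrite eq_le aT/=.
rewrite -ler_pdivlMl ?normr_gt0// -normfV.
by rewrite -[T in leLHS](scalerK a0) aT.
Qed.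

Lemma opnorm_eq0 (T : boundedOp) : opnorm T = 0 -> T = 0.
Proof.
move=> T0; apply/val_inj/funext => x /=; apply/eqP; rewrite -normr_le0.
by have := opnormP T x; rewrite T0 mul0r.
Qed.

HB.instance Definition _ := @Lmodule_isNormed.Build R boundedOp
  opnorm opnormD opnormZ opnorm_eq0.

End bounded_operators.

Section identity.
Context {R : realType} (X : normedModType R).

Lemma id_bounded_op : (@id X) \in @bounded_op_pred R X X.
Proof. by apply/mem_set; split=> //; exists 1 => x; rewrite mul1r. Qed.

Definition id_op : boundedOp X X := BoundedOp id_bounded_op.

End identity.

(* The norm, hence the topology, of the dual is [opnorm]. *)
Definition dual {R : realType} (X : normedModType R) := boundedOp X R^o.

Section closed_subspace.
Context {R : realType}.

(* Linear closed subspaces. The type [subspaceType J] below carries the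
   subspace [J] as a normed module of its own, with the norm of [X]; it is
   complete as soon as [X] is. *)
Record closedSubspace (X : normedModType R) := ClosedSubspace {
  cs_set :> set X;
  cs_submod : submod_closed (mem cs_set);
  cs_closed : closed cs_set }.

Section normed.
Context (X : normedModType R) (J : closedSubspace X).

Definition cs_pred : {pred X} := mem (cs_set J).

HB.instance Definition _ := GRing.isSubmodClosed.Build R X cs_pred (cs_submod J).

Record subspaceType := SubspaceElt { cs_val :> X; _ : cs_val \in cs_pred }.

HB.instance Definition _ := [isSub for cs_val].
HB.instance Definition _ := [Choice of subspaceType by <:].
HB.instance Definition _ := [SubChoice_isSubLmodule of subspaceType by <:].

Lemma cs_normD (x y : subspaceType) :
  `|val (x + y)| <= `|val x| + `|val y|.
Proof. exact: ler_normD. Qed.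

Lemma cs_normZ (a : R) (x : subspaceType) : `|val (a *: x)| = `|a| * `|val x|.
Proof. exact: normrZ. Qed.

Lemma cs_norm0 (x : subspaceType) : `|val x| = 0 -> x = 0.
Proof. by move/normr0_eq0 => x0; exact: val_inj. Qed.

HB.instance Definition _ := @Lmodule_isNormed.Build R subspaceType
  (fun x => `|val x|) cs_normD cs_normZ cs_norm0.

End normed.

Section complete.
Context (X : completeNormedModType R) (J : closedSubspace X).

Lemma cs_complete (F : set_system (subspaceType J)) :
  ProperFilter F -> cauchy F -> cvg F.
Proof.
move=> FF /cauchy_ballP Fc.
have Gc : cauchy (cs_val (J := J) @ F).
  apply/cauchy_ballP => e e0; have := Fc e e0.
  rewrite !near_simpl => -[[A B] /= [FA FB] AB].
  exists (cs_val (J := J) @` A, cs_val (J := J) @` B) => /=.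
    by split; [apply: filterS FA|apply: filterS FB] => x Ax; exists x.
  move=> [_ _] [/= [x Ax <-] [y By <-]].
  by have := AB (x, y) (conj Ax By); rewrite -!ball_normE.
have /cvg_ex /= [l Gl] : cvg (cs_val (J := J) @ F) by exact: cauchy_cvg.
have Jl : l \in cs_pred J.
  apply: mem_set; apply: (closed_cvg (u_ := cs_val (J := J)) _ _ _ _ Gl).
    exact: cs_closed.
  by apply: nearW => x; exact/set_mem/(valP x).
apply/cvg_ex; exists (SubspaceElt Jl); apply/cvgrPdist_lt => e e0.
by move/cvgrPdist_lt: Gl => /(_ e e0).
Qed.

HB.instance Definition _ := Uniform_isComplete.Build (subspaceType J) cs_complete.

End complete.
End closed_subspace.

Section daugavet.
Context {R : realType}.

(* The range is one-dimensional, so the zero operator is excluded. *)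
Definition rank_one (X Y : normedModType R) (T : boundedOp X Y) : Prop :=
  exists2 y, y != 0 & range T = [set a *: y | a in [set: R]].

Definition daugavet (X : completeNormedModType R) : Prop :=
  forall T : boundedOp X X, rank_one T -> `|id_op X + T| = 1 + `|T|.

Definition annihilator (X : normedModType R) (J : set X) : set (dual X) :=
  [set f : dual X | forall x, J x -> f x = 0].

Definition l1_direct_sum (E : normedModType R) (V W : set E) : Prop :=
  [/\ forall z, exists v w, [/\ V v, W w & z = v + w],
      V `&` W = [set 0] &
      forall v w, V v -> W w -> `|v + w| = `|v| + `|w|].

Definition M_ideal (X : normedModType R) (J : closedSubspace X) : Prop :=
  exists V : closedSubspace (dual X), l1_direct_sum V (annihilator J).

End daugavet.

(* Main.v *)
Require Import Defs.
From mathcomp Require Import all_boot all_order all_algebra.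
From mathcomp Require Import all_classical all_reals.
From mathcomp Require Import topology normedtype.
From mathcomp Require Import lra.

Set Implicit Arguments.
Unset Strict Implicit.
Unset Printing Implicit Defensive.

Import Order.TTheory GRing.Theory Num.Theory.
Import numFieldNormedType.Exports.

Local Open Scope classical_set_scope.
Local Open Scope ring_scope.

(** Let X* = V (+)_1 J^perp. Restriction to J is an isometric isomorphism of V
    onto J*: a Hahn-Banach extension F of f in J* splits as v + w, and
    |v| <= |v| + |w| = |F| <= |f|, so v is an extension of f in V of norm at
    most |f| ([l1_summand_extension]); and an element of V is determined by its
    restriction because V and J^perp meet in 0 ([l1_summand_norm_le]).

    Let T y = f(y) y0 be a rank one operator on J, extend f to xs in V, and put
    S x = xs(x) y0, a rank one operator on X that extends T. The adjoint of
    Id + S maps v + w to (v + v(y0) xs) + w, since w(y0) = 0. The first summand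
    is in V and restricts on J to the functional v o (Id + T), so its norm is at
    most |v| |Id + T|. Hence the adjoint sends v + w to a functional of norm at
    most |v| |Id + T| + |w| <= max(1, |Id + T|) |v + w|, which gives
    |Id + S| <= max(1, |Id + T|) ([id_tensor_norm_le]).

    The Daugavet property of X turns this into
    1 + |T| <= 1 + |S| = |Id + S| <= max(1, |Id + T|), and T <> 0 rules out the
    value 1 of the maximum. The opposite inequality is the triangle inequality.

    The Hahn-Banach theorem itself is proved with Zorn's lemma applied to graphs
    of dominated linear functionals. *)

(** * The Hahn-Banach theorem *)

Section hahn_banach.
Context {R : realType} (X : lmodType R) (p : X -> R).
Hypothesis p_subadd : forall x y, p (x + y) <= p x + p y.
Hypothesis p_homog : forall a x, 0 < a -> p (a *: x) = a * p x.

(** The graph of a linear functional on a subspace of [X] that lies below [p].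
    Single-valuedness follows from the other conditions: if [(x, a)] and [(x, b)]
    are in [G] then so is [(0, a - b)], whence [a - b <= p 0 = 0]. *)
Definition dominated_graph (G : set (X * R^o)) : Prop :=
  [/\ G 0, forall a u v, G u -> G v -> G (a *: u + v) &
      forall u, G u -> u.2 <= p u.1].

(** [Zorn_bigcup] also asks about the union of the empty chain, so it is applied
    to the sets that become dominated graphs once [G0] is added to them: the
    empty set is one of them. *)
Lemma dominated_graph_maximal (G0 : set (X * R^o)) : dominated_graph G0 ->
  exists G, [/\ dominated_graph G, G0 `<=` G &
    forall H, dominated_graph H -> G `<=` H -> H `<=` G].
Proof.
move=> dG0.
pose P := [set G : set (X * R^o) | dominated_graph (G0 `|` G)].
have [F FP Ftot|A [PA Amax]] := @Zorn_bigcup _ P.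
  have FG G : F G -> G0 `|` G `<=` G0 `|` \bigcup_(B in F) B.
    by move=> FG u [|Gu]; [left|right; exists G].
  have common u v : (G0 `|` \bigcup_(B in F) B) u ->
      (G0 `|` \bigcup_(B in F) B) v ->
      exists H, [/\ dominated_graph H,
        H `<=` G0 `|` \bigcup_(B in F) B, H u & H v].
    move=> [G0u|[A FA Au]] [G0v|[B FB Bv]].
    - by exists G0; split=> //; left.
    - by exists (G0 `|` B); split; [exact: FP|exact: FG|left|right].
    - by exists (G0 `|` A); split; [exact: FP|exact: FG|right|left].
    - have [AB|BA] := Ftot _ _ FA FB.
      + by exists (G0 `|` B); split;
          [exact: FP|exact: FG|right; exact: AB|right].
      + by exists (G0 `|` A); split;
          [exact: FP|exact: FG|right|right; exact: BA].
  split.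
  - by left; case: dG0.
  - move=> a u v Gu Gv; have [H [[_ HD _] HG Hu Hv]] := common _ _ Gu Gv.
    by apply: HG; exact: HD.
  - by move=> u Gu; have [H [[_ _ Hp] _ Hu _]] := common _ _ Gu Gu; exact: Hp.
exists (G0 `|` A); split=> // H dH GH.
apply: contrapT => HG; apply: (Amax H).
  split; first by apply: subset_trans GH; exact: subsetUr.
  by move=> HA; apply: HG => u /HA; right.
rewrite /P/= (_ : G0 `|` H = H)//; apply/setUidPr.
by apply: subset_trans GH; exact: subsetUl.
Qed.

(** The value [b] at [z] has to satisfy [u.2 - p (u.1 - z) <= b] and
    [b <= p (v.1 + z) - v.2] for all [u] and [v] in [G]; every left-hand side is
    below every right-hand side by subadditivity, so their supremum is a possible
    [b]. The conditions on the other multiples of [z] follow by homogeneity. *)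
Lemma dominated_graph_step (G : set (X * R^o)) z : dominated_graph G ->
  exists b : R, dominated_graph
    [set u | exists c v, G v /\ u = v + c *: ((z, b) : X * R^o)].
Proof.
move=> [G0 GD Gp].
have GD1 u v : G u -> G v -> G (u + v).
  by move=> Gu Gv; rewrite -[u]scale1r; exact: GD.
have GZ a u : G u -> G (a *: u).
  by move=> Gu; rewrite -[_ *: _]addr0; exact: GD.
pose S := [set v.2 - p (v.1 - z) | v in G].
have S_ub v : G v -> ubound S (p (v.1 + z) - v.2).
  move=> Gv _ [u Gu <-]; rewrite lerBrDr addrAC lerBlDr.
  apply: le_trans (Gp _ (GD1 _ _ Gu Gv)) _ => /=.
  rewrite (_ : u.1 + v.1 = (v.1 + z) + (u.1 - z)) ?p_subadd//.
  by rewrite [RHS]addrACA subrr addr0 addrC.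
have S_sup : has_sup S.
  by split; [exists (0 - p (0 - z)), 0|exists (p (0 + z) - 0); exact: (S_ub 0)].
exists (sup S); split.
- by exists 0, 0; split=> //; rewrite scale0r addr0.
- move=> a _ _ [c [u [Gu ->]]] [d [v [Gv ->]]].
  exists (a * c + d), (a *: u + v); split; first exact: GD.
  by rewrite scalerDr scalerA addrACA -scalerDl.
- move=> _ [c [v [Gv ->]]] /=.
  have [c0|c0|->] := ltgtP c 0; last by rewrite !scale0r !addr0; exact: Gp.
  + have c0' : 0 < - c by rewrite oppr_gt0.
    have := sup_upper_bound S_sup (ex_intro2 _ _ _ (GZ (- c)^-1 _ Gv) erefl).
    rewrite /= -(ler_pM2l c0') mulrBr -p_homog//.
    have -> : - c *: ((- c)^-1 *: v.1 - z) = v.1 + c *: z.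
      by rewrite scalerBr scalerA mulfV ?gt_eqF// scale1r scaleNr opprK.
    by rewrite /GRing.scale/= mulVKf ?gt_eqF//; lra.
  + have := ge_sup (proj1 S_sup) (S_ub _ (GZ c^-1 _ Gv)).
    rewrite /= -(ler_pM2l c0) mulrBr -p_homog//.
    have -> : c *: (c^-1 *: v.1 + z) = v.1 + c *: z.
      by rewrite scalerDr scalerA mulfV ?gt_eqF// scale1r.
    by rewrite /GRing.scale/= mulVKf ?gt_eqF//; lra.
Qed.

Theorem hahn_banach (G0 : set (X * R^o)) : dominated_graph G0 ->
  exists g : X -> R^o, [/\ linear g, forall x, g x <= p x &
    forall x a, G0 (x, a) -> g x = a].
Proof.
move=> /dominated_graph_maximal[G [dG G0G Gmax]].
have [Gz GD Gp] := dG.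
have G_total x : exists a, G (x, a).
  have [b dH] := dominated_graph_step x dG; exists b.
  apply: (Gmax _ dH).
    by move=> u Gu; exists 0, u; rewrite scale0r addr0.
  by exists 1, 0; rewrite scale1r add0r.
have p0 : p 0 = 0 by have := p_homog 0 (ltr0n R 2); rewrite scaler0; lra.
have G_fun x a b : G (x, a) -> G (x, b) -> a = b.
  have le c d : G (x, c) -> G (x, d) -> c <= d.
    move=> Gc Gd; have /Gp/= := GD (-1) _ _ Gd Gc.
    by rewrite !scaleN1r addNr p0 addrC subr_le0.
  by move=> Ga Gb; apply/eqP; rewrite eq_le !le.
have [g Gg] := choice G_total.
exists g; split.
- by move=> a x y; apply: (G_fun (a *: x + y)) => //; exact: (GD a (x, g x) (y, g y)).
- by move=> x; exact: (Gp _ (Gg x)).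
- by move=> x a /G0G Ga; exact: (G_fun x).
Qed.

End hahn_banach.

(** * Bounded functionals and operators *)

Section bounded.
Context {R : realType}.

Lemma boundedOp_exists (X Y : normedModType R) (f : X -> Y) (M : R) :
  0 <= M -> linear f -> (forall x, `|f x| <= M * `|x|) ->
  exists F : boundedOp X Y, (forall x, F x = f x) /\ `|F| <= M.
Proof.
move=> M0 lf fM.
have fb : f \in @bounded_op_pred R X Y by apply/mem_set; split=> //; exists M.
exists (BoundedOp fb); split=> //; apply: opnorm_le => x x1 /=.
by rewrite (le_trans (fM x))// ler_piMr.
Qed.

Lemma hahn_banach_norm (X : normedModType R) (M : R) (G0 : set (X * R^o)) :
  0 <= M -> dominated_graph (fun x => M * `|x|) G0 ->
  exists g : dual X, `|g| <= M /\ forall x a, G0 (x, a) -> g x = a.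
Proof.
move=> M0 /hahn_banach[x y|a x a0|g [lg gM gG]].
- by rewrite -mulrDr ler_wpM2l ?ler_normD.
- by rewrite normrZ gtr0_norm// mulrCA.
have gN x : g (- x) = - g x.
  have g0 : g 0 = 0 by have := lg (-1) 0 0; rewrite scaler0 addr0 scaleN1r addNr.
  by have := lg (-1) x 0; rewrite !scaleN1r g0 !addr0.
have [|g' [g'E g'M]] := boundedOp_exists M0 lg.
  by move=> x; rewrite ler_norml gM andbT lerNl -gN -[`|x|]normrN gM.
by exists g'; split=> // x a /gG <-.
Qed.

Lemma norming_functional (X : normedModType R) (x : X) :
  exists g : dual X, `|g| <= 1 /\ g x = `|x|.
Proof.
pose G0 := [set u | exists c : R, u = c *: ((x, `|x|) : X * R^o)].
have [||g [g1 gG]] := @hahn_banach_norm X 1 G0 => //.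
  split.
  - by exists 0; rewrite scale0r.
  - by move=> a _ _ [c ->] [d ->]; exists (a * c + d); rewrite scalerDl scalerA.
  - move=> _ [c ->] /=; rewrite mul1r normrZ.
    by rewrite /GRing.scale/= ler_wpM2r// ler_norm.
by exists g; split=> //; apply: gG; exists 1; rewrite scale1r.
Qed.

Lemma subspace_extension (X : normedModType R) (J : closedSubspace X)
    (f : dual (subspaceType J)) :
  exists F : dual X, `|F| <= `|f| /\ forall y : subspaceType J, F (val y) = f y.
Proof.
pose G0 := [set u : X * R^o | exists y : subspaceType J, u = (val y, f y)].
have [lf _] := bopP f.
have [||F [Ff FG]] := @hahn_banach_norm X `|f| G0 => //.
  split.
  - by exists 0; rewrite bop0.
  - by move=> a _ _ [y ->] [z ->]; exists (a *: y + z); rewrite lf.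
  - by move=> _ [y ->] /=; rewrite (le_trans (ler_norm _))//; exact: opnormP.
by exists F; split=> // y; apply: FG; exists y.
Qed.

Lemma rank_one_tensor (X Y : normedModType R) (T : boundedOp X Y) :
  rank_one T -> exists (f : dual X) (y : Y), forall x, T x = f x *: y.
Proof.
move=> [y y0 Ty].
have ny0 : 0 < `|y| by rewrite normr_gt0.
have [f fT] : {f : X -> R^o & forall x, T x = (f x : R) *: y}.
  apply: (@choice _ _ (fun x (a : R^o) => T x = (a : R) *: y)) => x.
  have : range T (T x) by exists x.
  by rewrite Ty => -[a _ <-]; exists a.
(* Linearity of [f] is read off from that of [T] because [y] is nonzero. *)
have yI : injective (fun a : R^o => (a : R) *: y).
  move=> a b /eqP; rewrite -subr_eq0 -scalerBl scaler_eq0 (negbTE y0) orbF.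
  by rewrite subr_eq0 => /eqP.
have [lT _] := bopP T.
have [|||F [FE _]] := @boundedOp_exists X R^o f (`|T| / `|y|).
- by rewrite divr_ge0.
- move=> a u v; apply: yI => /=.
  by rewrite -fT lT !fT scalerDl scalerA.
- move=> x; rewrite mulrAC ler_pdivlMr//.
  by rewrite -normrZ -fT; exact: opnormP.
by exists F, y => x; rewrite FE.
Qed.

End bounded.

(** * Dual of an M-ideal *)

Section l1_summand.
Context {R : realType}.

(** The component in [V] of any norm-preserving extension of [f] still extends
    [f], and it is no longer than the whole because the sum is an l1-sum. *)
Lemma l1_summand_extension (X : normedModType R) (J : closedSubspace X)
    (V : closedSubspace (dual X)) (f : dual (subspaceType J)) :
  l1_direct_sum V (annihilator J) ->
  exists v : dual X,
    [/\ cs_set V v, `|v| <= `|f| & forall y : subspaceType J, v (val y) = f y].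
Proof.
move=> [Vsum _ Vnorm]; have [F [Ff FE]] := subspace_extension f.
have [v [w [Vv Jw Fvw]]] := Vsum F; exists v; split=> //.
  by apply: le_trans Ff; rewrite Fvw Vnorm// lerDl.
move=> y; have Jy : cs_set J (val y) := set_mem (valP y).
rewrite -FE Fvw; transitivity (v (val y) + w (val y)); last by [].
by rewrite (Jw _ Jy) addr0.
Qed.

(** The restriction of [v] to [J] has an extension [v'] in [V] that is not longer
    than the restriction; [v - v'] is in [V] and vanishes on [J], so [v = v']. *)
Lemma l1_summand_norm_le (X : normedModType R) (J : closedSubspace X)
    (V : closedSubspace (dual X)) (v : dual X) (M : R) :
  l1_direct_sum V (annihilator J) -> cs_set V v -> 0 <= M ->
  (forall y : subspaceType J, `|v (val y)| <= M * `|y|) -> `|v| <= M.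
Proof.
move=> Vsum Vv M0 vM.
have [f [fE fM]] : exists f : dual (subspaceType J),
    (forall y, f y = v (val y)) /\ `|f| <= M.
  apply: boundedOp_exists => // a y z.
  by have [lv _] := bopP v; rewrite /= lv.
have [v' [Vv' v'f v'E]] := l1_summand_extension f Vsum.
suff -> : v = v' by exact: le_trans fM.
have [V0 VD] := cs_submod V.
have [_ VJ _] := Vsum.
have : (V `&` annihilator J) (v - v').
  split.
    rewrite addrC -scaleN1r; apply/set_mem; apply: VD; exact/mem_set.
  move=> x Jx; have xJ : x \in cs_pred J by exact/mem_set.
  rewrite (_ : (v - v') x = v x - v' x)//.
  by rewrite -[x]/(val (SubspaceElt xJ)) v'E fE subrr.
by rewrite VJ => /eqP; rewrite subr_eq0 => /eqP.
Qed.

(** The norm of [x + S x] is computed with a norming functional [g = v + w]; what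
    is estimated is the adjoint of [Id + S] at [g]. *)
Lemma id_tensor_norm_le (X : normedModType R) (J : closedSubspace X)
    (V : closedSubspace (dual X)) (xs : dual X) (y0 : subspaceType J)
    (S : boundedOp X X) (T : boundedOp (subspaceType J) (subspaceType J)) :
  l1_direct_sum V (annihilator J) -> cs_set V xs ->
  (forall x, S x = xs x *: val y0) -> (forall y, T y = xs (val y) *: y0) ->
  `|id_op X + S| <= Num.max 1 `|id_op (subspaceType J) + T|.
Proof.
move=> Vsum Vxs SE TE; have [Vsplit _ Vnorm] := Vsum.
pose N : R := `|id_op (subspaceType J) + T|.
have N0 : 0 <= N by exact: normr_ge0.
have NT (y : subspaceType J) : `|y + T y| <= N * `|y|.
  exact: (opnormP (id_op _ + T) y).
have ST (y : subspaceType J) : S (val y) = val (T y) by rewrite SE TE.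
apply: opnorm_le => x x1.
have [g [g1 <-]] := norming_functional ((id_op X + S) x).
have [v [w [Vv Jw gE]]] := Vsplit g.
have vw1 : `|v| + `|w| <= 1 by rewrite -Vnorm// -gE.
(* [u] is the component in [V] of the image of [g] under the adjoint. *)
pose u : dual X := v (val y0) *: xs + v.
have Vu : cs_set V u.
  have [_ VD] := cs_submod V.
  by apply/set_mem; apply: VD; exact/mem_set.
have uE z : u z = v (z + S z).
  have [lv _] := bopP v.
  transitivity (v (val y0) * xs z + v z) => //.
  by rewrite SE [z + _]addrC lv mulrC.
have uN : `|u| <= `|v| * N.
  apply: (l1_summand_norm_le Vsum) => //; first by rewrite mulr_ge0.
  move=> y; rewrite uE ST -mulrA.
  apply: le_trans (opnormP v _) _.
  by apply: ler_wpM2l; [exact: opnorm_ge0|exact: NT].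
have -> : g ((id_op X + S) x) = u x + w x.
  have Jwy : w (val y0) = 0 by apply: Jw; exact/set_mem/(valP y0).
  have [lw _] := bopP w.
  transitivity (v (x + S x) + w (x + S x)); first by rewrite gE.
  by rewrite uE SE [x + _]addrC lw Jwy scaler0 add0r.
have ux : u x <= `|u| by exact: le_trans (ler_norm _) (opnorm_ub u x1).
have wx : w x <= `|w| by exact: le_trans (ler_norm _) (opnorm_ub w x1).
have M1 : 1 <= Num.max 1 N by rewrite le_max lexx.
have MN : N <= Num.max 1 N by rewrite le_max lexx orbT.
have v0 : 0 <= `|v| by [].
have w0 : 0 <= `|w| by [].
(* u x + w x <= |v| N + |w| <= (|v| + |w|) max(1, N) <= max(1, N) *)
nra.
Qed.

End l1_summand.

(** * Inheritance of the Daugavet property *)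

Theorem proposition2p10 (R : realType) (X : completeNormedModType R)
    (J : closedSubspace X) :
  daugavet X -> M_ideal J -> daugavet (subspaceType J).
Proof.
move=> dX [V Vsum] T rT.
have [f [y0 Tf]] := rank_one_tensor rT.
have [xs [Vxs _ xsf]] := l1_summand_extension f Vsum.
have Txs y : T y = xs (val y) *: y0 by rewrite xsf Tf.
have [lxs _] := bopP xs.
have [S [SE _]] : exists S : boundedOp X X,
    (forall x, S x = xs x *: val y0) /\ `|S| <= `|xs| * `|y0|.
  apply: boundedOp_exists; first by rewrite mulr_ge0.
    by move=> a x z; rewrite lxs scalerDl scalerA.
  by move=> x; rewrite normrZ mulrAC ler_wpM2r//; exact: opnormP.
have ST (y : subspaceType J) : S (val y) = val (T y) by rewrite SE Txs.
have T_gt0 : 0 < `|T|.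
  rewrite normr_gt0; apply/eqP => T0; have [y ny0 rangeT] := rT.
  have : range T y by rewrite rangeT; exists 1 => //; rewrite scale1r.
  by move=> [x _]; rewrite T0 => y_eq0; move: ny0; rewrite -y_eq0 eqxx.
have TS : `|T| <= `|S|.
  apply: opnorm_le => y y1.
  have : `|S (val y)| <= opnorm S by exact: opnorm_ub.
  by rewrite ST.
have S_rank : rank_one S.
  have [y ny0 rangeT] := rT.
  have [y1 _ Ty] : range T y by rewrite rangeT; exists 1 => //; rewrite scale1r.
  have y00 : val y0 != 0.
    by apply: contra_neq ny0 => y00; rewrite -Ty Tf; apply/val_inj => /=;
      rewrite y00 scaler0.
  have xs1 : xs (val y1) != 0.
    by apply: contra_neq ny0; rewrite -Ty Tf xsf => ->; rewrite scale0r.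
  exists (val y0) => //; apply/seteqP; split.
    by move=> _ [x _ <-]; exists (xs x).
  move=> _ [a _ <-]; exists ((a / xs (val y1)) *: val y1) => //.
  by rewrite bopZ SE scalerA divfK.
have S_le := id_tensor_norm_le Vsum Vxs SE Txs.
apply/eqP; rewrite eq_le; apply/andP; split.
  by rewrite (le_trans (ler_normD _ _))// lerD2r; exact: opnorm_le.
(* 1 + |S| <= 1 is impossible, since |S| >= |T| > 0. *)
by move: S_le; rewrite (dX _ S_rank) le_max => /orP[|]; lra.
Qed.
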